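(* Let $n \ge 1$ and let $f(Z) \in \mathbb{C}[Z]$ be a psd-stable polynomial on the space of complex symmetric $n \times n$ matrices $Z$. Then the polynomial $$\det(Z)^{\deg(f)} \cdot f(-Z^{-1})$$ is psd-stable.
   Context: $\mathcal{S}_n^{\mathbb{C}}$ denotes the space of complex symmetric (not Hermitian) $n\times n$ matrices. $\mathbb{C}[Z]$ denotes the ring of polynomials in the entries $z_{ij}$ of a symmetric $n\times n$ variable matrix $Z=(z_{ij})$, where $z_{ij}$ and $z_{ji}$ are identified; equivalently, the polynomial ring $\mathbb{C}[\{z_{ij} : 1\le i\le j\le n\}]$. $\deg(f)$ is the total degree. $\mathrm{Im}(M)$ is the entrywise imaginary part of a matrix $M$. A polynomial $f\in\mathbb{C}[Z]$ is called psd-stable if $f(M)\neq 0$ for every $M\in\mathcal{S}_n^{\mathbb{C}}$ such that $\mathrm{Im}(M)$ is positive definite. The factor $\det(Z)^{\deg(f)}$ serves to make the displayed expression a polynomial. *)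

(* Defs.v *)
From HB Require Import structures.
From mathcomp Require Import all_boot all_order all_algebra.
From mathcomp Require Import reals complex mpoly.

Set Implicit Arguments.
Unset Strict Implicit.
Unset Printing Implicit Defensive.

Import Order.TTheory GRing.Theory Num.Theory.

Local Open Scope ring_scope.

(* z_ij and z_ji are the same indeterminate, indexed by (i, j) with i <= j. *)
Definition sympair (n : nat) := {p : 'I_n * 'I_n | (p.1 <= p.2)%N}.

Definition nsym (n : nat) : nat := #|{: sympair n}|.

Definition sympair_of (n : nat) (k : 'I_(nsym n)) : 'I_n * 'I_n :=
  val (enum_val k : sympair n).

Definition sort_ord (n : nat) (i j : 'I_n) : 'I_n * 'I_n :=
  if (i <= j)%N then (i, j) else (j, i).

Fact sort_ord_le (n : nat) (i j : 'I_n) :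
  ((sort_ord i j).1 <= (sort_ord i j).2)%N.
Proof. by rewrite /sort_ord; case: ifP => //= /negbT; rewrite -ltnNge => /ltnW. Qed.

Definition symidx (n : nat) (i j : 'I_n) : 'I_(nsym n) :=
  enum_rank (exist _ (sort_ord i j) (sort_ord_le i j) : sympair n).

Notation "'CZ[ R , n ]" := {mpoly (complex R)[nsym n]}
  (at level 8, format "''CZ[' R ,  n ]") : type_scope.

(* msize is the total degree plus one (and 0 for the zero polynomial). *)
Definition total_degree (n : nat) (C : nzRingType) (f : {mpoly C[n]}) : nat :=
  (msize f).-1.

(* Only the entries A i j with i <= j are read: A is meant to be symmetric. *)
Definition symeval (n : nat) (C S : nzRingType) (phi : C -> S)
    (A : 'M[S]_n) (f : {mpoly C[nsym n]}) : S :=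
  mmap phi (fun k => A (sympair_of k).1 (sympair_of k).2) f.

Definition posdefmx (R : realType) (n : nat) (Y : 'M[R]_n) : Prop :=
  Y^T = Y /\ forall v : 'rV[R]_n, v != 0 -> 0 < (v *m Y *m v^T) 0 0.

Definition psd_stable (R : realType) (n : nat) (f : 'CZ[R, n]) : Prop :=
  forall M : 'M[complex R]_n,
    M^T = M -> posdefmx (map_mx (@complex.Im R) M) -> symeval idfun M f != 0.

Definition symvarmx (R : realType) (n : nat) : 'M['CZ[R, n]]_n :=
  \matrix_(i, j) 'X_(symidx i j).

(* The variable matrix over the field of rational functions, where Z^-1 and
   hence f(- Z^-1) make sense. *)
Definition fracvarmx (R : realType) (n : nat) : 'M[{fraction 'CZ[R, n]}]_n :=
  map_mx (@tofrac _) (symvarmx R n).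

Definition fracconst (R : realType) (n : nat) (c : complex R) :
    {fraction 'CZ[R, n]} :=
  tofrac (c%:MP : 'CZ[R, n]).

Definition neg_inv_transform (R : realType) (n : nat) (f : 'CZ[R, n]) :
    {fraction 'CZ[R, n]} :=
  \det (fracvarmx R n) ^+ total_degree f
    * symeval (@fracconst R n) (- invmx (fracvarmx R n)) f.

(* Main.v *)
(** Clearing denominators in [f(- Z^-1)] with [Z^-1 = adj Z / det Z] gives a
    polynomial [g], and [g(M) = det(M)^(deg f) * f(- M^-1)] whenever [M] is
    invertible.  It remains to see that [M |-> - M^-1] preserves the Siegel
    upper half-space.  Let [M = A + i B] be symmetric with [B] positive definite,
    and let [u = x + i y] be a row vector such that [w = u M] is real.  Then
    [x B = - y A], hence [- Im (u w^T) = - y (x A - y B)^T = x B x^T + y B y^T],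
    which is positive unless [u = 0].  Taking [w = 0] shows that [M] is
    invertible; taking [u = w M^-1] with [w] real and nonzero shows that
    [Im (- M^-1)] is positive definite. *)

Require Import Defs.
From HB Require Import structures.
From mathcomp Require Import all_boot all_order all_algebra.
From mathcomp Require Import reals complex mpoly.

Set Implicit Arguments.
Unset Strict Implicit.
Unset Printing Implicit Defensive.

Import Order.TTheory GRing.Theory Num.Theory.

Local Open Scope ring_scope.

Section ComplexMatrices.

Variable R : rcfType.

Local Notation ReM := (map_mx (@complex.Re R)).
Local Notation ImM := (map_mx (@complex.Im R)).

Lemma Re_mulmx m n p (A : 'M[complex R]_(m, n)) (B : 'M[complex R]_(n, p)) :
  ReM (A *m B) = ReM A *m ReM B - ImM A *m ImM B.
Proof.
apply/matrixP=> i j; rewrite !mxE.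
rewrite (big_morph (@complex.Re R) (id1 := 0) (op1 := +%R)); last 2 first.
- by case=> a b [c d].
- by [].
rewrite -sumrB; apply: eq_bigr => k _; rewrite !mxE.
by case: (A i k) => a b; case: (B k j) => c d.
Qed.

Lemma Im_mulmx m n p (A : 'M[complex R]_(m, n)) (B : 'M[complex R]_(n, p)) :
  ImM (A *m B) = ReM A *m ImM B + ImM A *m ReM B.
Proof.
apply/matrixP=> i j; rewrite !mxE.
rewrite (big_morph (@complex.Im R) (id1 := 0) (op1 := +%R)); last 2 first.
- by case=> a b [c d].
- by [].
rewrite -big_split; apply: eq_bigr => k _; rewrite !mxE.
by case: (A i k) => a b; case: (B k j) => c d.
Qed.

Lemma Re_Im_mx_eq0 m n (A : 'M[complex R]_(m, n)) :
  ReM A = 0 -> ImM A = 0 -> A = 0.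
Proof.
move=> /matrixP rA /matrixP iA; apply/matrixP=> i j.
by move: (rA i j) (iA i j); rewrite !mxE; case: (A i j) => a b /= -> ->.
Qed.

Lemma Im_mul_real_image n (M : 'M[complex R]_n) (u : 'rV_n) :
  M^T = M -> ImM (u *m M) = 0 ->
  - ImM (u *m (u *m M)^T) =
    ReM u *m ImM M *m (ReM u)^T + ImM u *m ImM M *m (ImM u)^T.
Proof.
move=> symM Im0.
have symA : (ReM M)^T = ReM M by rewrite map_trmx symM.
have symB : (ImM M)^T = ImM M by rewrite map_trmx symM.
have xB : ReM u *m ImM M = - (ImM u *m ReM M).
  by apply/eqP; rewrite -addr_eq0 -Im_mulmx Im0.
rewrite Im_mulmx -!map_trmx Im0 trmx0 mulmx0 add0r Re_mulmx linearB /= !trmx_mul.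
by rewrite symA symB xB mulmxBr !mulmxA opprB mulNmx addrC.
Qed.

End ComplexMatrices.

Section SiegelHalfSpace.

Variables (R : realType) (n : nat) (M : 'M[complex R]_n).
Hypotheses (symM : M^T = M) (posM : posdefmx (map_mx (@complex.Im R) M)).

Lemma Im_mul_real_image_gt0 (u : 'rV_n) :
  u != 0 -> map_mx (@complex.Im R) (u *m M) = 0 ->
  0 < (- map_mx (@complex.Im R) (u *m (u *m M)^T)) 0 0.
Proof.
move=> u0 Im0; rewrite (Im_mul_real_image symM Im0) mxE.
have [_ pos] := posM.
have ge0 (v : 'rV_n) : 0 <= (v *m map_mx (@complex.Im R) M *m v^T) 0 0.
  have [->|v0] := eqVneq v 0; first by rewrite !mul0mx mxE.
  exact/ltW/pos.
(* Both terms are nonnegative, and as [u] is nonzero its real or its imaginary part makes one of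
   them strictly positive. *)
have [x0|x0] := eqVneq (map_mx (@complex.Re R) u) 0; last first.
  by apply: ltr_wpDr; [exact: ge0 | exact: pos].
apply: ltr_wpDl; [exact: ge0 | apply: pos].
by apply: contraNneq u0 => y0; rewrite (Re_Im_mx_eq0 x0 y0).
Qed.

Lemma Siegel_unitmx : M \in unitmx.
Proof.
rewrite unitmxE unitfE; apply/negP => /det0P [u u0 uM].
have Im0 : map_mx (@complex.Im R) (u *m M) = 0.
  by rewrite uM; apply/matrixP=> i j; rewrite !mxE.
have := Im_mul_real_image_gt0 u0 Im0.
by rewrite uM trmx0 mulmx0 !mxE oppr0 ltxx.
Qed.

Lemma Siegel_opp_inv_sym : (- invmx M)^T = - invmx M.
Proof. by rewrite linearN /= trmx_inv symM. Qed.

Lemma Siegel_opp_inv_posdef :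
  posdefmx (map_mx (@complex.Im R) (- invmx M)).
Proof.
split=> [|w w0]; first by rewrite map_trmx Siegel_opp_inv_sym.
pose wC := map_mx (real_complex R) w.
have ReC : map_mx (@complex.Re R) wC = w by apply/matrixP=> i j; rewrite !mxE.
have ImC : map_mx (@complex.Im R) wC = 0 by apply/matrixP=> i j; rewrite !mxE.
have uM : wC *m invmx M *m M = wC by rewrite mulmxKV // Siegel_unitmx.
have u0 : wC *m invmx M != 0.
  apply: contra_neq w0 => u0.
  by rewrite -ReC -uM u0 mul0mx; apply/matrixP=> i j; rewrite !mxE.
have := Im_mul_real_image_gt0 u0; rewrite uM => /(_ ImC).
congr (0 < _).
(* As [w] is real, only the imaginary part of [invmx M] survives between [w] and its transpose; the
   sign then moves onto it. *)
rewrite !Im_mulmx -!map_trmx ReC ImC trmx0 mulmx0 mul0mx addr0 add0r.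
rewrite -mulNmx -mulmxN; congr ((_ *m _ *m _) _ _).
by apply/matrixP=> i j; rewrite !mxE; case: (invmx M i j).
Qed.

End SiegelHalfSpace.

Section ClearedTransform.

Variables (n : nat) (C : nzRingType).

(** Free of division, so that one formula serves over polynomials, rational functions and complex
    numbers, and commutes with ring morphisms between them. *)
Definition cleared_transform (S : comNzRingType) (phi : C -> S) (A : 'M[S]_n)
    (f : {mpoly C[nsym n]}) : S :=
  \sum_(m <- msupp f) phi f@_m * (\det A ^+ (total_degree f - mdeg m) *
    mmap1 (fun k => - \adj A (sympair_of k).1 (sympair_of k).2) m).

Lemma rmorph_cleared_transform (S T : comNzRingType) (psi : {rmorphism S -> T})
    (phi : C -> S) (A : 'M[S]_n) (f : {mpoly C[nsym n]}) :
  psi (cleared_transform phi A f) =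
    cleared_transform (psi \o phi) (map_mx psi A) f.
Proof.
rewrite rmorph_sum; apply: eq_bigr => m _.
rewrite !rmorphM rmorphXn det_map_mx /mmap1 rmorph_prod; congr (_ * (_ * _)).
apply: eq_bigr => k _.
by rewrite rmorphXn rmorphN -map_mx_adj [in RHS]mxE.
Qed.

Lemma cleared_transformE (K : fieldType) (phi : C -> K) (A : 'M[K]_n)
    (f : {mpoly C[nsym n]}) :
  A \in unitmx ->
  cleared_transform phi A f =
    \det A ^+ total_degree f * symeval phi (- invmx A) f.
Proof.
move=> uA; rewrite /symeval /mmap mulr_sumr.
rewrite /cleared_transform !big_seq; apply: eq_bigr => m m_f.
rewrite [RHS]mulrCA; congr (_ * _).
(* On the support of [f] the natural subtraction in the exponent is never truncated. *)
have le_m : (mdeg m <= total_degree f)%N.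
  by have := msize_mdeg_lt m_f; rewrite /total_degree; case: (msize f).
rewrite -{2}(subnK le_m) exprD -mulrA; congr (_ * _).
(* The factor [\det A ^+ mdeg m] is shared out, one determinant per occurrence of a variable, each
   cancelling the denominator of an entry of [invmx A]. *)
rewrite mdegE -prodrXr /mmap1 -big_split; apply: eq_bigr => k _ /=.
rewrite -exprMn /invmx uA !mxE mulrN mulVKf //.
by rewrite -unitfE -unitmxE.
Qed.

End ClearedTransform.

Section VariableMatrix.

Variables (R : realType) (n : nat).

Lemma sympair_of_symidx (i j : 'I_n) : sympair_of (symidx i j) = sort_ord i j.
Proof. by rewrite /sympair_of /symidx enum_rankK. Qed.

(** A named form of [symeval idfun M], to which the ring morphism structure is attached. *)
Definition evalmx (M : 'M[complex R]_n) : 'CZ[R, n] -> complex R :=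
  mmap idfun (fun k => M (sympair_of k).1 (sympair_of k).2).

HB.instance Definition _ (M : 'M[complex R]_n) :=
  GRing.RMorphism.copy (evalmx M)
    (mmap idfun (fun k => M (sympair_of k).1 (sympair_of k).2)).

Lemma map_symvarmx (M : 'M[complex R]_n) :
  M^T = M -> map_mx (evalmx M) (symvarmx R n) = M.
Proof.
move=> symM; apply/matrixP=> i j.
rewrite !mxE /evalmx mmapX mmap1U sympair_of_symidx /sort_ord.
by case: ifP => //= _; rewrite -{1}symM mxE.
Qed.

(** The determinant of the variable matrix is a nonzero polynomial, since it takes the value 1 at
    the identity matrix. *)
Lemma fracvarmx_unit : fracvarmx R n \in unitmx.
Proof.
rewrite unitmxE unitfE det_map_mx tofrac_eq0.
apply: contra_neq (oner_neq0 (complex R)) => det0.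
have := det_map_mx (evalmx 1%:M) (symvarmx R n).
by rewrite map_symvarmx ?trmx1 // det1 det0 rmorph0.
Qed.

End VariableMatrix.

Theorem theorem4p3 (R : realType) (n : nat) (hn : (0 < n)%N)
    (f : 'CZ[R, n]) (hf : psd_stable f) :
  exists g : 'CZ[R, n], tofrac g = neg_inv_transform f /\ psd_stable g.
Proof.
exists (cleared_transform (@mpolyC _ _) (symvarmx R n) f); split.
  rewrite rmorph_cleared_transform /neg_inv_transform.
  by rewrite -cleared_transformE ?fracvarmx_unit.
(* Evaluation at [M] sends the variable matrix to [M], which is invertible, so the cleared formula
   factors over the complex numbers too. *)
move=> M symM posM; rewrite -[symeval _ _ _]/(evalmx M _) rmorph_cleared_transform.
rewrite map_symvarmx // cleared_transformE ?Siegel_unitmx //.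
(* Evaluation at [M] fixes the constant coefficients. *)
have -> : symeval (evalmx M \o @mpolyC _ _) (- invmx M) f =
          symeval idfun (- invmx M) f.
  by apply: eq_bigr => m _; rewrite /= /evalmx mmapC.
apply: mulf_neq0.
  by rewrite expf_neq0 // -unitfE -unitmxE Siegel_unitmx.
apply: hf; first exact: Siegel_opp_inv_sym.
exact: Siegel_opp_inv_posdef.
Qed.
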